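(* The 189-set $\mathcal{O}_3\cup\mathcal{O}_4\cup\mathcal{O}_5$ is a $\mathcal{G}_{\mathcal{S}}$-invariant quartic hypersurface in $\operatorname{PG}(7,2)$ with equation $Q_4'(x)=0$, where $$Q_4'=P_2'+P_3'+P_3''+P_4'.$$
   Context: Everything is over $\operatorname{GF}(2)$. Let $V_2$ be a 2-dimensional vector space over $\operatorname{GF}(2)$ with nonzero vectors $u_0,u_1,u_2$ (so $u_2=u_0+u_1$), and $V_8=V_2\otimes V_2\otimes V_2$. Points of $\operatorname{PG}(7,2)=\mathbb{P}V_8$ are identified with nonzero vectors of $V_8$. Put $E_{ijk}=u_i\otimes u_j\otimes u_k$ for $i,j,k\in\{0,1,2\}$. The Segre variety is the 27-point set $\mathcal{S}=\mathcal{S}_{1,1,1}(2)=\{E_{ijk}\}$; $\mathcal{G}_{\mathcal{S}}$ is its stabilizer in $\operatorname{GL}(V_8)$, equal to $\mathcal{N}\rtimes\operatorname{Sym}(3)$ where $\mathcal{N}=\operatorname{GL}(V_2)^3$ acts by maps $a_1\otimes a_2\otimes a_3$ and $\operatorname{Sym}(3)$ permutes the tensor factors. $\mathcal{O}_5=\mathcal{S}$; $\mathcal{O}_4$ is the set of points outside $\mathcal{S}$ lying on some distinguished tangent $L(p)$, $p\in\mathcal{S}$, where $L(p)=\{p,p',p''\}$ and $p',p''$ are the two points of the 3-flat spanned by the three generators through $p$ that lie in none of the three planes spanned by two of these generators (generators are the lines in $\mathcal{S}$ obtained by fixing two indices of $E_{ijk}$ and letting the third vary); $\mathcal{O}_3$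 is the set of points $E_{ijk}+E_{i'j'k'}$ with $i\ne i'$, $j\ne j'$, $k\ne k'$. (These are $\mathcal{G}_{\mathcal{S}}$-orbits of sizes 27, 54, 108.) Every point set $\psi\subseteq\operatorname{PG}(7,2)$ is the set of points $x$ with $Q(x)=0$ for a unique reduced polynomial $Q$ with zero constant term, i.e. a sum of squarefree monomials $x_{i_1}\cdots x_{i_k}$, $k\ge1$, $i_1<\cdots<i_k$; ''quartic hypersurface'' means this polynomial has degree 4. Coordinates $x_1,\dots,x_8$ are with respect to the basis $e_1=E_{000}$, $e_2=E_{100}$, $e_3=E_{110}$, $e_4=E_{010}$, $e_5=E_{101}$, $e_6=E_{001}$, $e_7=E_{011}$, $e_8=E_{111}$. Writing $ij$, $ijk$, $ijkl$ for the monomials $x_ix_j$, $x_ix_jx_k$, $x_ix_jx_kx_l$: $P_2'=13+15+17+35+37+57+24+26+28+46+48+68$; $P_3'=135+137+157+357+246+248+268+468$; $P_3''=\sum_{i\ne1,8}x_1x_8x_i+\sum_{i\ne2,7}x_2x_7x_i+\sum_{i\ne3,6}x_3x_6x_i+\sum_{i\ne4,5}x_4x_5x_i$ (with $i\in\{1,\dots,8\}$); $P_4'=1278+1368+1458+2367+2457+3456$. *)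

(* Defs.v *)
From mathcomp Require Export all_boot all_order all_algebra all_fingroup all_character.
From mathcomp Require Export mxtens mpoly.

Set Implicit Arguments.
Unset Strict Implicit.
Unset Printing Implicit Defensive.

Import GRing.Theory.
Local Open Scope ring_scope.

Notation V2 := 'rV['F_2]_2.

(* V2 (x) V2 (x) V2, the tensor product of row vectors being the Kronecker
   product of matrices; the dimension 2 * 2 * 2 is convertible to 8. *)
Notation V8 := 'rV['F_2]_8.

(* The action of GL(V8) on V8 by v |-> v *m g; the argument of GLrepr is the
   dimension minus one. *)
Notation GL8_action := ('MR (GLrepr 'F_2 7))%act.

Section Segre.

(* The three nonzero vectors u_0, u_1, u_2 of V2; that they are nonzero and
   distinct is assumed where the definitions are used. *)
Variable u : 'I_3 -> V2.

Definition E (i j k : 'I_3) : V8 := u i *t u j *t u k.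

Definition segre : {set V8} := [set E t.1.1 t.1.2 t.2 | t : 'I_3 * 'I_3 * 'I_3].

Definition segre_stab : {group {'GL_8['F_2]}} := 'N(segre | GL8_action)%G.

Definition generators : {set {set V8}} :=
  [set [set E i t.1 t.2 | i : 'I_3] | t : 'I_3 * 'I_3] :|:
  [set [set E t.1 j t.2 | j : 'I_3] | t : 'I_3 * 'I_3] :|:
  [set [set E t.1 t.2 k | k : 'I_3] | t : 'I_3 * 'I_3].

Definition generators_at (p : V8) : {set {set V8}} :=
  [set g in generators | p \in g].

(* The projective subspace spanned by A, as a set of points, i.e. of nonzero
   vectors. *)
Definition flat (A : {set V8}) : {set V8} :=
  [set x | (x != 0) && (x \in <<enum A>>%VS)].

(* L(p), for p in segre. *)
Definition tangent (p : V8) : {set V8} :=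
  p |: [set x in flat (cover (generators_at p)) |
         [forall g in generators_at p, forall h in generators_at p,
            (g != h) ==> (x \notin flat (g :|: h))]].

Definition O5 : {set V8} := segre.

Definition O4 : {set V8} := (\bigcup_(p in segre) tangent p) :\: segre.

Definition O3 : {set V8} :=
  [set x | [exists i, exists j, exists k, exists i', exists j', exists k',
     [&& i != i', j != j', k != k' & x == E i j k + E i' j' k']]].

(* The basis e_1, ..., e_8: e_(n+1) is the item of rank n. *)
Definition ebasis : 8.-tuple V8 :=
  let i0 : 'I_3 := inord 0 in
  let i1 : 'I_3 := inord 1 in
  [tuple E i0 i0 i0; E i1 i0 i0; E i1 i1 i0; E i0 i1 i0;
         E i1 i0 i1; E i0 i0 i1; E i0 i1 i1; E i1 i1 i1].

Definition reduced_equation (psi : {set V8}) (Q : {mpoly 'F_2[8]}) : Prop :=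
  [/\ forall m : 'X_{1..8}, m \in msupp Q -> forall i, (m i <= 1)%N,
      Q@_0%MM = 0 &
      psi = [set x : V8 | (x != 0) && (Q.@[fun i => coord ebasis i x] == 0)]].

(* The reduced equation of psi is unique; msize is the degree plus one. *)
Definition quartic_hypersurface (psi : {set V8}) : Prop :=
  exists2 Q, reduced_equation psi Q & msize Q = 5%N.

End Segre.

(* The variable x_n for 1 <= n <= 8 is the one of index n - 1 in 'I_8. *)
Definition xvar (n : nat) : {mpoly 'F_2[8]} := 'X_(inord n.-1).

(* [:: [:: i; j]; [:: k; l]] stands for x_i x_j + x_k x_l. *)
Definition sum_monomials (s : seq (seq nat)) : {mpoly 'F_2[8]} :=
  \sum_(m <- s) \prod_(i <- m) xvar i.

Definition P2' : {mpoly 'F_2[8]} := sum_monomials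
  [:: [:: 1; 3]; [:: 1; 5]; [:: 1; 7]; [:: 3; 5]; [:: 3; 7]; [:: 5; 7];
      [:: 2; 4]; [:: 2; 6]; [:: 2; 8]; [:: 4; 6]; [:: 4; 8]; [:: 6; 8]]%N.

Definition P3' : {mpoly 'F_2[8]} := sum_monomials
  [:: [:: 1; 3; 5]; [:: 1; 3; 7]; [:: 1; 5; 7]; [:: 3; 5; 7];
      [:: 2; 4; 6]; [:: 2; 4; 8]; [:: 2; 6; 8]; [:: 4; 6; 8]]%N.

Definition P3'' : {mpoly 'F_2[8]} :=
  (\sum_(1 <= i < 9 | (i != 1%N) && (i != 8%N)) xvar 1 * xvar 8 * xvar i) +
  (\sum_(1 <= i < 9 | (i != 2%N) && (i != 7%N)) xvar 2 * xvar 7 * xvar i) +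
  (\sum_(1 <= i < 9 | (i != 3%N) && (i != 6%N)) xvar 3 * xvar 6 * xvar i) +
  (\sum_(1 <= i < 9 | (i != 4%N) && (i != 5%N)) xvar 4 * xvar 5 * xvar i).

Definition P4' : {mpoly 'F_2[8]} := sum_monomials
  [:: [:: 1; 2; 7; 8]; [:: 1; 3; 6; 8]; [:: 1; 4; 5; 8];
      [:: 2; 3; 6; 7]; [:: 2; 4; 5; 7]; [:: 3; 4; 5; 6]]%N.

Definition Q4' : {mpoly 'F_2[8]} := P2' + P3' + P3'' + P4'.

(* Main.v *)
Require Import Defs.

(** The vectors [u 0], [u 1], [u 2] are all the nonzero vectors of a plane over
    GF(2), and such vectors are told apart by the functionals [v *m perp (u i)],
    which vanish exactly at [u i].  Tensoring these functionals gives covectors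
    [dualE i j k] whose value at [E a b c] is 1 exactly when the two index
    triples differ in all three places ([mulE_dualE]).  The basis [ebasis]
    lists the vertices of a cube so that the (n+1)-st and the (8-n)-th are
    antipodal; hence, up to reversing the order, the basis is dual to itself
    under this pairing.  This gives explicit coordinates of every [E i j k],
    and every question about V8 becomes a question about bit strings of
    length 8 ([coords_E], [coordsD], [coords_inj], [coords_onto]).

    The set [O4] is the only one whose definition is not explicit.  The lines
    through [p = E i j k] are the three obtained by varying one index
    ([lines_atE]).  If [A], [B], [C] are further points on them, a point
    of the 3-flat is a combination of [p], [A], [B], [C], and it avoids the three
    planes exactly when [A], [B] and [C] all occur in it ([tangent_pointP]).
    The two possibilities [A + B + C] and [p + A + B + C] have the same shape,
    since [p + A] is again a point of the line through [p] and [A].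

    The points in [O3], [O4] and [O5] are thus listed by their coordinates; there
    are 189 of them, and evaluating the polynomial at the 255 nonzero bit
    strings shows that they are its zeros ([O345_bits_quartic]).  The polynomial
    is a sum of square-free monomials, of which 1278 occurs once, so it is
    reduced and of degree 4.

    For the invariance, the 189-set is recovered from the Segre variety alone:
    it consists of the vectors that are the sum of an even number of 3-subsets
    of [segre u] ([mem_O345_triples]).  Any linear permutation of the variety
    preserves these numbers. *)

Set Implicit Arguments.
Unset Strict Implicit.
Unset Printing Implicit Defensive.

Import GRing.Theory.
Local Open Scope ring_scope.

(** * Linear algebra over GF(2) *)

Lemma F2_cases (a : 'F_2) : a = 0 \/ a = 1.
Proof. by case: a => [[|[|//]] ?]; [left | right]; apply/val_inj. Qed.

Lemma F2_natb (a : 'F_2) : a = (a != 0)%:R.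
Proof. by case: (F2_cases a) => ->. Qed.

Lemma F2_nat_eq0 n : (n%:R == 0 :> 'F_2) = ~~ odd n.
Proof. by rewrite -dvdn2 (dvdn_pcharf (pchar_Fp _)). Qed.

Lemma addF2_neq0 (a b : 'F_2) : (a + b != 0) = (a != 0) (+) (b != 0).
Proof. by case: (F2_cases a) (F2_cases b) => -> [] ->. Qed.

Lemma oppv_F2 n (x : 'rV['F_2]_n) : - x = x.
Proof.
by apply/rowP=> i; rewrite mxE; case: (F2_cases (x 0 i)) => ->; apply/val_inj.
Qed.

(** The functional whose kernel is spanned by [v]: it is the determinant of a
    vector together with [v]. *)
Definition perp (v : 'rV['F_2]_2) : 'cV['F_2]_2 := \col_i v 0 (i + 1).

Lemma row2_eqE (x y : 'rV['F_2]_2) :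
  (x == y) = (x 0 0 == y 0 0) && (x 0 1 == y 0 1).
Proof.
apply/eqP/andP=> [-> //|[/eqP e0 /eqP e1]]; apply/rowP=> i.
have [->//|->//] : i = 0 \/ i = 1.
by case: i => [[|[|//]] lti]; [left | right]; apply/val_inj.
Qed.

(** Over GF(2) two nonzero vectors are dependent only when they are equal. *)
Lemma mul_perp (v w : 'rV['F_2]_2) :
  v != 0 -> w != 0 -> (v *m perp w) 0 0 = (v != w)%:R.
Proof.
rewrite !row2_eqE [LHS]mxE big_ord_recl big_ord1.
have -> : lift ord0 ord0 = 1 :> 'I_2 by exact/val_inj.
have e11 : 1 + 1 = 0 :> 'I_2 by exact/val_inj.
rewrite !mxE e11 add0r.
case: (F2_cases (v 0 0)) => ->; case: (F2_cases (v 0 1)) => ->;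
case: (F2_cases (w 0 0)) => ->; case: (F2_cases (w 0 1)) => ->.
all: rewrite ?mulr0 ?mul0r ?mulr1 ?addr0 ?add0r ?eqxx ?oner_eq0 ?(eq_sym 0).
all: rewrite ?oner_eq0 //=.
all: by move=> _ _; apply/val_inj.
Qed.

Lemma mul_tens_rv_cv m n (v : 'rV['F_2]_m) (w : 'rV['F_2]_n)
    (x : 'cV['F_2]_m) (y : 'cV['F_2]_n) :
  ((v *t w) *m (x *t y) : 'M_1) 0 0 = (v *m x) 0 0 * (w *m y) 0 0.
Proof.
have e0 : 0 = mxtens_index (0, 0) :> 'I_(1 * 1) by apply/val_inj.
by rewrite tensmx_mul [in LHS]e0 [LHS]tensmxE.
Qed.

Lemma tensmxDl m n p q (A B : 'M['F_2]_(m, n)) (C : 'M['F_2]_(p, q)) :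
  (A + B) *t C = A *t C + B *t C.
Proof. by apply/matrixP=> i j; rewrite !mxE mulrDl. Qed.

Lemma tensmxDr m n p q (A : 'M['F_2]_(m, n)) (B C : 'M['F_2]_(p, q)) :
  A *t (B + C) = A *t B + A *t C.
Proof. by apply/matrixP=> i j; rewrite !mxE mulrDr. Qed.

Lemma mem_span_cons_F2 (vT : vectType 'F_2) (x v : vT) (X : seq vT) :
    x \in <<v :: X>>%VS ->
  x \in <<X>>%VS \/ exists2 y, y \in <<X>>%VS & x = v + y.
Proof.
rewrite span_cons => /memv_addP[_ /vlineP[k ->] [y y_in ->]].
case: (F2_cases k) => ->; rewrite ?scale0r ?scale1r ?add0r; first by left.
by right; exists y.
Qed.

Lemma memv_span_consD (vT : vectType 'F_2) (x v : vT) (X : seq vT) :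
  x \in <<X>>%VS -> v + x \in <<v :: X>>%VS.
Proof. by rewrite span_cons; apply: memv_add; apply: memv_line. Qed.

(** A point of the 3-flat on [p], [a], [b], [c] that is outside the planes
    [pbc], [pac] and [pab] must involve each of [a], [b] and [c]; only the
    coefficient of [p] is left free. *)
Lemma span4_F2 (vT : vectType 'F_2) (a b c p x : vT) :
    x \in <<[:: a; b; c; p]>>%VS ->
  [\/ x \in <<[:: b; c; p]>>%VS, x \in <<[:: a; c; p]>>%VS,
      x \in <<[:: a; b; p]>>%VS
    | x = a + b + c \/ x = (p + a) + b + c].
Proof.
case/mem_span_cons_F2=> [|[y y_in ->]]; first by constructor 1.
have [|[z z_in ->]] := mem_span_cons_F2 y_in.
  by constructor 2; apply: memv_span_consD.
have [|[w w_in ->]] := mem_span_cons_F2 z_in.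
  by constructor 3; do 2!apply: memv_span_consD.
constructor 4; have [|[v]] := mem_span_cons_F2 w_in; rewrite span_nil memv0.
  by move/eqP->; left; rewrite addr0 addrA.
move=> /eqP-> ->; right.
by rewrite addr0 [c + p]addrC [b + _]addrCA [a + _]addrCA !addrA.
Qed.

Lemma span_mul0 n (A : {set 'rV['F_2]_n}) (d : 'cV['F_2]_n) x :
    {in A, forall y, (y *m d) 0 0 = 0} ->
  x \in <<enum A>>%VS -> (x *m d) 0 0 = 0.
Proof.
move=> Ad0; suff /subvP sub : (<<enum A>> <= lker (linfun (mulmxr d)))%VS.
  by move/sub; rewrite memv_ker lfunE => /eqP /= ->; rewrite mxE.
apply/span_subvP=> y; rewrite mem_enum memv_ker lfunE => /Ad0 /= yd0.
by apply/eqP/matrixP=> i j; rewrite !ord1 yd0 mxE.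
Qed.

(** * The tangents of a 3 x 3 x 3 grid of points *)

Lemma I3_cases (i a l : 'I_3) : i != a -> [\/ l = i, l = a | l = - (i + a)].
Proof.
move=> ia; have: [|| l == i, l == a | l == - (i + a)].
  by case: i a l ia => [[|[|[|//]]] ?] [[|[|[|//]]] ?] [[|[|[|//]]] ?].
by case/or3P=> /eqP; [constructor 1 | constructor 2 | constructor 3].
Qed.

Lemma I3_third (i a : 'I_3) : i != a -> i != - (i + a).
Proof. by case: i a => [[|[|[|//]]] ?] [[|[|[|//]]] ?]. Qed.

Lemma I3_neq (i : 'I_3) : i != i + 1.
Proof. by case: i => [[|[|[|//]]] ?]. Qed.

(** The tangents depend on the points [E u i j k] only through the following
    properties.  The index on a line that differs from [i] and [a] is
    [- (i + a)], computed modulo 3. *)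
Section Grid.

Variable e : 'I_3 -> 'I_3 -> 'I_3 -> 'rV['F_2]_8.
Variable d : 'I_3 -> 'I_3 -> 'I_3 -> 'cV['F_2]_8.
Hypothesis mul_dual : forall a b c i j k,
  (e a b c *m d i j k) 0 0 = [&& a != i, b != j & c != k]%:R.
Hypothesis e_addl : forall i a j k,
  i != a -> e i j k + e a j k = e (- (i + a)) j k.
Hypothesis e_addm : forall i j b k,
  j != b -> e i j k + e i b k = e i (- (j + b)) k.
Hypothesis e_addr : forall i j k c,
  k != c -> e i j k + e i j c = e i j (- (k + c)).
Hypothesis e_inj : forall a b c i j k,
  e a b c = e i j k -> [/\ a = i, b = j & c = k].

Definition line1 j k : {set 'rV['F_2]_8} := [set e i j k | i : 'I_3].
Definition line2 i k : {set 'rV['F_2]_8} := [set e i j k | j : 'I_3].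
Definition line3 i j : {set 'rV['F_2]_8} := [set e i j k | k : 'I_3].

Definition grid_lines : {set {set 'rV['F_2]_8}} :=
  [set line1 t.1 t.2 | t : 'I_3 * 'I_3] :|:
  [set line2 t.1 t.2 | t : 'I_3 * 'I_3] :|:
  [set line3 t.1 t.2 | t : 'I_3 * 'I_3].

Definition lines_at i j k : {set {set 'rV['F_2]_8}} :=
  [set g in grid_lines | e i j k \in g].

Lemma mem_line1 i j k : e i j k \in line1 j k. Proof. exact: imset_f. Qed.
Lemma mem_line2 i j k : e i j k \in line2 i k. Proof. exact: imset_f. Qed.
Lemma mem_line3 i j k : e i j k \in line3 i j. Proof. exact: imset_f. Qed.

Lemma lines_atE i j k :
  lines_at i j k = [set line1 j k; line2 i k; line3 i j].
Proof.
apply/setP=> g; rewrite !inE; apply/andP/idP.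
  case; case/orP=> [/orP[]|] /imsetP[[s t] _ ->] /= /imsetP[l _];
  by case/e_inj=> ? ? ?; subst; rewrite eqxx ?orbT.
have in1 : line1 j k \in [set line1 t.1 t.2 | t : 'I_3 * 'I_3].
  by apply/imsetP; exists (j, k).
have in2 : line2 i k \in [set line2 t.1 t.2 | t : 'I_3 * 'I_3].
  by apply/imsetP; exists (i, k).
have in3 : line3 i j \in [set line3 t.1 t.2 | t : 'I_3 * 'I_3].
  by apply/imsetP; exists (i, j).
case/orP=> [/orP[]|] /eqP->; split; rewrite ?in1 ?in2 ?in3 ?orbT //.
all: exact: imset_f.
Qed.

Lemma line1_sub i a j k (U : {vspace 'rV['F_2]_8}) :
  i != a -> e i j k \in U -> e a j k \in U -> {subset line1 j k <= U}.
Proof.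
move=> ia iU aU _ /imsetP[l _ ->].
by case: (I3_cases l ia) => ->; rewrite -1?e_addl //; apply: memvD.
Qed.

Lemma line2_sub i j b k (U : {vspace 'rV['F_2]_8}) :
  j != b -> e i j k \in U -> e i b k \in U -> {subset line2 i k <= U}.
Proof.
move=> jb jU bU _ /imsetP[m _ ->].
by case: (I3_cases m jb) => ->; rewrite -1?e_addm //; apply: memvD.
Qed.

Lemma line3_sub i j k c (U : {vspace 'rV['F_2]_8}) :
  k != c -> e i j k \in U -> e i j c \in U -> {subset line3 i j <= U}.
Proof.
move=> kc kU cU _ /imsetP[n _ ->].
by case: (I3_cases n kc) => ->; rewrite -1?e_addr //; apply: memvD.
Qed.

Definition tangent_point i j k a b c : 'rV['F_2]_8 :=
  e a j k + e i b k + e i j c.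

Lemma tangent_point_dual i j k a b c l m n :
  (tangent_point i j k a b c *m d l m n) 0 0 =
  ([&& a != l, j != m & k != n] (+) [&& i != l, b != m & k != n]
   (+) [&& i != l, j != m & c != n])%:R.
Proof.
rewrite !mulmxDl [LHS]mxE [X in X + _]mxE !mul_dual -!natrD.
by apply/eqP; do 3!case: [&& _, _ & _].
Qed.

(** If [e l m n] were this point, its first index would be [i], because
    [d l j (k + 1)] kills [e l m n] but not the point when [l != i]; and it
    would not be [i], because of [d i (j + 1) (k + 1)]. *)
Lemma tangent_point_neq i j k a b c l m n :
  i != a -> j != b -> k != c -> tangent_point i j k a b c <> e l m n.
Proof.
move=> ia jb kc eq_e; have [[i1 j1] k1] := (I3_neq i, I3_neq j, I3_neq k).
have [eq_li|li] := eqVneq l i.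
  have := tangent_point_dual i j k a b c i (j + 1) (k + 1).
  rewrite eq_e mul_dual eq_li eqxx j1 k1 [a == i]eq_sym ia /=.
  by apply/eqP; rewrite eq_sym oner_eq0.
have := tangent_point_dual i j k a b c l j (k + 1).
rewrite eq_e mul_dual !eqxx k1 [i == l]eq_sym li [b == j]eq_sym jb !andbF /=.
by apply/eqP; rewrite eq_sym oner_eq0.
Qed.

(** That the points avoid the three planes is seen from a covector, such as
    [d (i + 1) (j + 1) k] for the plane on [line1 j k] and [line2 i k], which
    vanishes on the plane but not at the point. *)
Lemma tangent_pointP i j k x :
  reflect (exists a b c, [/\ i != a, j != b, k != c
             & x = tangent_point i j k a b c])
    ((x \in e i j k |: [set y in flat (cover (lines_at i j k)) |
        [forall g in lines_at i j k, forall h in lines_at i j k,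
           (g != h) ==> (y \notin flat (g :|: h))]])
     && (x != e i j k)).
Proof.
rewrite in_setU1 andb_orl andbN /= inE lines_atE.
pose L := [set line1 j k; line2 i k; line3 i j]; rewrite -/L.
have L1 : line1 j k \in L by rewrite !inE eqxx.
have L2 : line2 i k \in L by rewrite !inE eqxx orbT.
have L3 : line3 i j \in L by rewrite !inE eqxx orbT.
have neq12 : line1 j k != line2 i k.
  apply/eqP=> /setP/(_ (e (i + 1) j k)); rewrite mem_line1.
  by case/esym/imsetP=> l _ /e_inj[/eqP]; rewrite eq_sym (negPf (I3_neq i)).
have neq13 : line1 j k != line3 i j.
  apply/eqP=> /setP/(_ (e (i + 1) j k)); rewrite mem_line1.
  by case/esym/imsetP=> l _ /e_inj[/eqP]; rewrite eq_sym (negPf (I3_neq i)).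
have neq23 : line2 i k != line3 i j.
  apply/eqP=> /setP/(_ (e i (j + 1) k)); rewrite mem_line2.
  by case/esym/imsetP=> l _ /e_inj[_ /eqP]; rewrite eq_sym (negPf (I3_neq j)).
apply: (iffP andP) => [[/andP[]]|[a [b [c [ia jb kc ->]]]]].
  rewrite inE => /andP[x_neq0 x_in] no_plane x_neqp.
  have out g h (X : seq 'rV['F_2]_8) : g \in L -> h \in L -> g != h ->
      {subset X <= g :|: h} -> x \in <<X>>%VS -> False.
    move=> gL hL gh subX x_inX; move/forallP/(_ g)/implyP/(_ gL): no_plane.
    move/forallP/(_ h)/implyP/(_ hL)/implyP/(_ gh).
    rewrite inE x_neq0 /= => /negP[]; apply: subvP x_inX; apply: sub_span => y.
    by rewrite mem_enum; apply: subX.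
  have [[a ia] [b jb] [c kc]] :
      [/\ exists a, i != a, exists b, j != b & exists c, k != c].
    split; [exists (i + 1) | exists (j + 1) | exists (k + 1)];
    exact: I3_neq.
  have : x \in <<[:: e a j k; e i b k; e i j c; e i j k]>>%VS.
    apply: subvP x_in; apply/span_subvP=> y; rewrite mem_enum => /bigcupP[g].
    set X := [:: _; _; _; _].
    have subX t : t \in X -> t \in <<X>>%VS by apply: memv_span.
    have [P_X [A_X B_X C_X]] : e i j k \in X /\
        [/\ e a j k \in X, e i b k \in X & e i j c \in X].
      by split; [|split]; rewrite !in_cons eqxx ?orbT.
    rewrite !in_setU !in_set1 -orbA => /or3P[] /eqP->.
    - by apply: (line1_sub ia); apply: subX.
    - by apply: (line2_sub jb); apply: subX.
    - by apply: (line3_sub kc); apply: subX.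
  case/span4_F2.
  - case/(out _ _ _ L2 L3 neq23) => z; rewrite !in_cons in_nil orbF in_setU.
    by case/or3P=> /eqP->;
      [rewrite mem_line2 | rewrite mem_line3 orbT | rewrite mem_line2].
  - case/(out _ _ _ L1 L3 neq13) => z; rewrite !in_cons in_nil orbF in_setU.
    by case/or3P=> /eqP->;
      [rewrite mem_line1 | rewrite mem_line3 orbT | rewrite mem_line1].
  - case/(out _ _ _ L1 L2 neq12) => z; rewrite !in_cons in_nil orbF in_setU.
    by case/or3P=> /eqP->;
      [rewrite mem_line1 | rewrite mem_line2 orbT | rewrite mem_line1].
  case=> ->; [exists a | exists (- (i + a))]; exists b, c; first by split.
  by split=> //; [apply: I3_third | rewrite e_addl].
have [[i1 j1] k1] := (I3_neq i, I3_neq j, I3_neq k).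
set x' := tangent_point i j k a b c.
have f12 : (x' *m d (i + 1) (j + 1) k) 0 0 = 1.
  by rewrite tangent_point_dual eqxx i1 j1 [c == k]eq_sym kc !andbF.
have f13 : (x' *m d (i + 1) j (k + 1)) 0 0 = 1.
  by rewrite tangent_point_dual eqxx i1 k1 [b == j]eq_sym jb !andbF.
have f23 : (x' *m d i (j + 1) (k + 1)) 0 0 = 1.
  by rewrite tangent_point_dual eqxx j1 k1 [a == i]eq_sym ia.
have out (X Y : {set 'rV['F_2]_8}) l m n : (x' *m d l m n) 0 0 = 1 ->
    {in X, forall y, (y *m d l m n) 0 0 = 0} ->
    {in Y, forall y, (y *m d l m n) 0 0 = 0} -> x' \notin flat (X :|: Y).
  move=> x1 X0 Y0; rewrite inE negb_and; apply/orP; right; apply/negP.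
  move/(@span_mul0 _ _ (d l m n)); rewrite x1 => /(_ _)/eqP.
  by rewrite oner_eq0; case/(_ _)/negP=> // y /setUP[/X0|/Y0].
have line1_0 l m n : j = m \/ k = n ->
    {in line1 j k, forall y, (y *m d l m n) 0 0 = 0}.
  move=> mn _ /imsetP[? _ ->]; rewrite mul_dual.
  by case: mn => ->; rewrite eqxx ?andbF.
have line2_0 l m n : i = l \/ k = n ->
    {in line2 i k, forall y, (y *m d l m n) 0 0 = 0}.
  move=> ln _ /imsetP[? _ ->]; rewrite mul_dual.
  by case: ln => ->; rewrite eqxx ?andbF.
have line3_0 l m n : i = l \/ j = m ->
    {in line3 i j, forall y, (y *m d l m n) 0 0 = 0}.
  move=> lm _ /imsetP[? _ ->]; rewrite mul_dual.
  by case: lm => ->; rewrite eqxx ?andbF.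
have out12 : x' \notin flat (line1 j k :|: line2 i k).
  by apply: (out _ _ _ _ _ f12); [apply: line1_0 | apply: line2_0]; right.
have out13 : x' \notin flat (line1 j k :|: line3 i j).
  by apply: (out _ _ _ _ _ f13);
    [apply: line1_0; left | apply: line3_0; right].
have out23 : x' \notin flat (line2 i k :|: line3 i j).
  by apply: (out _ _ _ _ _ f23); [apply: line2_0 | apply: line3_0]; left.
have x_neq0 : x' != 0.
  by apply: contra_eq_neq f23 => ->; rewrite mul0mx mxE eq_sym oner_eq0.
split; last first.
  by apply: contra_eq_neq f23 => ->; rewrite mul_dual eqxx eq_sym oner_eq0.
apply/andP; split.
  rewrite inE x_neq0.
  by do 2?apply: memvD; apply: memv_span; rewrite mem_enum; apply/bigcupP;
    [exists (line1 j k) | exists (line2 i k) | exists (line3 i j)];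
    rewrite ?mem_line1 ?mem_line2 ?mem_line3.
apply/forallP=> g; apply/implyP=> gL; apply/forallP=> h; apply/implyP=> hL.
apply/implyP; move: gL hL; rewrite !in_setU !in_set1 -!orbA.
case/or3P=> /eqP->; case/or3P=> /eqP->; rewrite ?eqxx // => _;
  first [done | by rewrite setUC].
Qed.

End Grid.

(** * Sums of square-free monomials *)

Definition P3''_monomials : seq (seq nat) :=
  [seq [:: p.1; p.2; i]
     | p <- [:: (1, 8); (2, 7); (3, 6); (4, 5)]%N,
       i <- [seq i <- iota 1 8 | (i != p.1) && (i != p.2)]].

Definition Q4'_monomials : seq (seq nat) :=
  [:: [:: 1; 3]; [:: 1; 5]; [:: 1; 7]; [:: 3; 5]; [:: 3; 7]; [:: 5; 7];
      [:: 2; 4]; [:: 2; 6]; [:: 2; 8]; [:: 4; 6]; [:: 4; 8]; [:: 6; 8]]%N ++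
  [:: [:: 1; 3; 5]; [:: 1; 3; 7]; [:: 1; 5; 7]; [:: 3; 5; 7];
      [:: 2; 4; 6]; [:: 2; 4; 8]; [:: 2; 6; 8]; [:: 4; 6; 8]]%N ++
  P3''_monomials ++
  [:: [:: 1; 2; 7; 8]; [:: 1; 3; 6; 8]; [:: 1; 4; 5; 8];
      [:: 2; 3; 6; 7]; [:: 2; 4; 5; 7]; [:: 3; 4; 5; 6]]%N.

Lemma sum_monomials_cat s t :
  sum_monomials (s ++ t) = sum_monomials s + sum_monomials t.
Proof. by rewrite /sum_monomials big_cat. Qed.

Lemma sum_monomials_cubics a b :
  \sum_(1 <= i < 9 | (i != a) && (i != b)) xvar a * xvar b * xvar i =
  sum_monomials [seq [:: a; b; i] | i <- iota 1 8 & (i != a) && (i != b)].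
Proof.
rewrite /sum_monomials big_map big_filter; apply: eq_bigr => i _.
by rewrite !big_cons big_nil mulr1 mulrA.
Qed.

Lemma P3''E : P3'' = sum_monomials P3''_monomials.
Proof. by rewrite /P3'' !sum_monomials_cubics -!sum_monomials_cat. Qed.

Lemma Q4'E : Q4' = sum_monomials Q4'_monomials.
Proof. by rewrite /Q4' P3''E /P2' /P3' /P4' -!sum_monomials_cat -!catA. Qed.

Definition monomial (s : seq nat) : 'X_{1..8} :=
  (\sum_(i <- s) U_(inord i.-1))%MM.

Lemma monomialE s : \prod_(i <- s) xvar i = 'X_[monomial s].
Proof. by rewrite (big_morph _ (@mpolyXD _ _) (mpolyX0 _ _)). Qed.

Lemma mdeg_monomial s : mdeg (monomial s) = size s.
Proof. by rewrite mdeg_sum -sum1_size; apply: eq_bigr => i _; rewrite mdeg1. Qed.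

Definition square_free (s : seq nat) : bool :=
  uniq s && all (fun i => 0 < i < 9)%N s.

Lemma square_freeE s (j : 'I_8) :
  square_free s -> monomial s j = (j.+1 \in s).
Proof.
case/andP=> uniq_s /allP s_range; rewrite -(count_uniq_mem _ uniq_s).
rewrite mnm_sumE -sum1_count [RHS]big_mkcond.
apply: eq_big_seq => -[|i] /s_range //= lti.
by rewrite mnm1E -val_eqE /= inordK // eqSS; case: eqP.
Qed.

Lemma eq_monomial s t : square_free s -> square_free t ->
  (monomial s == monomial t) = all (mem t) s && all (mem s) t.
Proof.
move=> sf_s sf_t; apply/eqP/andP=> [eq_st | [/allP sub_st /allP sub_ts]].
  have mem_st i : (0 < i < 9)%N -> (i \in s) = (i \in t).
    case: i => // i /andP[_ lti].
    have := congr1 (fun m : 'X_{1..8} => m (@Ordinal 8 i lti)) eq_st.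
    by rewrite !square_freeE //=; do 2!case: (_ \in _).
  have [/andP[_ /allP s_range] /andP[_ /allP t_range]] := (sf_s, sf_t).
  by split; apply/allP=> i i_in /=;
    [rewrite -mem_st ?s_range | rewrite mem_st ?t_range].
apply/mnmP=> i; rewrite !square_freeE //; congr nat_of_bool.
by apply/idP/idP; [apply: sub_st | apply: sub_ts].
Qed.

Lemma coef_sum_monomials L m :
  (sum_monomials L)@_m = (count (fun s => monomial s == m) L)%:R.
Proof.
rewrite /sum_monomials raddf_sum /= -sum1_count natr_sum [RHS]big_mkcond.
by apply: eq_bigr => s _; rewrite monomialE mcoeffX; case: ifP.
Qed.

Lemma eval_sum_monomials L v :
  (sum_monomials L).@[v] = (count (all (fun i => v (inord i.-1) != 0)) L)%:R.
Proof.
rewrite /sum_monomials rmorph_sum /= -sum1_count natr_sum [RHS]big_mkcond.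
apply: eq_bigr => s _; rewrite rmorph_prod /=.
elim: s => [|i s IHs]; rewrite ?big_nil // big_cons IHs mevalXU /=.
by rewrite {1}[v _]F2_natb; case: (_ != 0); rewrite ?mul0r ?mul1r.
Qed.

Lemma Q4'_square_free : {in Q4'_monomials, forall s, square_free s}.
Proof. by apply/allP; vm_compute. Qed.

Lemma msupp_Q4' m :
  m \in msupp Q4' -> exists2 s, s \in Q4'_monomials & m = monomial s.
Proof.
rewrite mcoeff_msupp Q4'E coef_sum_monomials => nz.
have /hasP[s s_in /eqP<-] : has (fun s => monomial s == m) Q4'_monomials.
  by rewrite has_count lt0n; apply: contraNneq nz => ->.
by exists s.
Qed.

(** The monomial 1278 occurs only once in the list, so it is not cancelled. *)
Lemma msize_Q4' : msize Q4' = 5.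
Proof.
apply/eqP; rewrite eqn_leq; apply/andP; split.
  rewrite msizeE; apply/bigmax_leqP_seq => m /msupp_Q4'[s s_in ->] _.
  by rewrite mdeg_monomial; move: s s_in; apply/allP.
pose t := [:: 1; 2; 7; 8]%N; have := @msize_mdeg_lt _ _ Q4' (monomial t).
rewrite mdeg_monomial; apply; rewrite mcoeff_msupp Q4'E coef_sum_monomials.
rewrite (@eq_in_count _ _ (fun s => all (mem t) s && all (mem s) t)).
  by rewrite F2_nat_eq0 negbK; vm_compute.
by move=> s s_in; rewrite eq_monomial // Q4'_square_free.
Qed.

Lemma Q4'_reduced m i : m \in msupp Q4' -> (m i <= 1)%N.
Proof.
case/msupp_Q4'=> s s_in ->; rewrite square_freeE ?Q4'_square_free //.
by case: (_ \in _).
Qed.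

Lemma Q4'_constant_coef : Q4'@_0%MM = 0.
Proof.
apply/eqP/negbNE; rewrite -mcoeff_msupp; apply/negP=> /msupp_Q4'[s s_in eq0].
have /eqP : mdeg (monomial s) = 0%N by rewrite -eq0 mdeg0.
by rewrite mdeg_monomial; apply/negP; move: s s_in {eq0}; apply/allP.
Qed.

(** * The point sets as lists of bit strings *)

(** Index triples with natural entries: unlike ordinals, on which membership
    proofs get in the way, they let the closed checks below be computed. *)
Definition cell := (nat * nat * nat)%type.

Definition cells : seq cell :=
  [seq (ij, k)
     | ij <- [seq (i, j) | i <- iota 0 3, j <- iota 0 3], k <- iota 0 3].

Definition antipodal (s t : cell) : bool :=
  [&& s.1.1 != t.1.1, s.1.2 != t.1.2 & s.2 != t.2].

Definition basis_cells : seq cell :=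
  [:: (0, 0, 0); (1, 0, 0); (1, 1, 0); (0, 1, 0);
      (1, 0, 1); (0, 0, 1); (0, 1, 1); (1, 1, 1)]%N.

(** The coordinates of the point of index [t], see [coords_E]; the reversal
    comes from [antipodal_basis]. *)
Definition tensor_bits (t : cell) : bitseq :=
  [seq antipodal t s | s <- rev basis_cells].

Definition xorb (s t : bitseq) : bitseq := [seq b.1 (+) b.2 | b <- zip s t].

Lemma mem_cells (t : cell) :
  (t \in cells) = [&& (t.1.1 < 3), (t.1.2 < 3) & (t.2 < 3)]%N.
Proof.
case: t => [[i j] k] /=.
by case: i => [|[|[|i]]]; case: j => [|[|[|j]]]; case: k => [|[|[|k]]].
Qed.

Lemma sub_basis_cells : {subset rev basis_cells <= cells}.
Proof. by apply/allP. Qed.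

Lemma antipodal_basis (i j : 'I_8) :
  antipodal (nth (0, 0, 0)%N basis_cells i)
            (nth (0, 0, 0)%N (rev basis_cells) j) = (i == j).
Proof.
rewrite -val_eqE.
by case: i => [[|[|[|[|[|[|[|[|//]]]]]]]] ?];
   case: j => [[|[|[|[|[|[|[|[|//]]]]]]]] ?].
Qed.

Lemma tensor_bits_inj : {in cells &, injective tensor_bits}.
Proof.
move=> s t s_in t_in /eqP eq_st; apply/eqP; move: eq_st; apply/implyP.
move: t t_in; apply/allP; move: s s_in.
apply: (allP (_ : all (fun s => all (fun t =>
  (tensor_bits s == tensor_bits t) ==> (s == t)) cells) cells)).
by vm_compute.
Qed.

Fixpoint bitstrings n : seq bitseq :=
  if n is n'.+1 then [seq b :: s | b <- [:: false; true], s <- bitstrings n']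
  else [:: [::]].

Lemma mem_bitstrings s : s \in bitstrings (size s).
Proof.
by elim: s => // b s IHs; apply/allpairsP; exists (b, s); split; first case: b.
Qed.

Definition segre_bits : seq bitseq := map tensor_bits cells.

Definition antipodal_pairs : seq (cell * cell) :=
  [seq p <- allpairs pair cells cells | antipodal p.1 p.2].

Definition O3_bits : seq bitseq :=
  [seq xorb (tensor_bits p.1) (tensor_bits p.2) | p <- antipodal_pairs].

Definition neighbour_cells (p : cell * cell) : cell * cell * cell :=
  ((p.2.1.1, p.1.1.2, p.1.2), (p.1.1.1, p.2.1.2, p.1.2),
   (p.1.1.1, p.1.1.2, p.2.2)).

Definition O4_bits : seq bitseq :=
  [seq xorb (xorb (tensor_bits n.1.1) (tensor_bits n.1.2)) (tensor_bits n.2)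
     | n <- map neighbour_cells antipodal_pairs].

Definition O345_bits : seq bitseq := undup (O3_bits ++ O4_bits ++ segre_bits).

Definition quartic_bits (s : bitseq) : bool :=
  odd (count (all (fun i => nth false s i.-1)) Q4'_monomials).

Lemma O345_bits_quartic :
  all (fun s => (s \in O345_bits) == (s != nseq 8 false) && ~~ quartic_bits s)
      (bitstrings 8).
Proof.
(* As an argument of a function, the list of points is evaluated only once. *)
pose test (P : seq bitseq) :=
  all (fun s => (s \in P) == (s != nseq 8 false) && ~~ quartic_bits s)
      (bitstrings 8).
suff: test O345_bits by [].
by vm_compute.
Qed.

Definition segre_triples_bits (s : bitseq) : nat :=
  sumn [seq count (fun q => xorb (xorb s p) q \in segre_bits) segre_bits
          | p <- segre_bits].

Lemma O345_bits_triples :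
  all (fun s => (s \in O345_bits) == (segre_triples_bits s %% 4 != 2)%N)
      (bitstrings 8).
Proof.
pose test (S P : seq bitseq) := all (fun s => (s \in P) ==
    (sumn [seq count (fun q => xorb (xorb s p) q \in S) S | p <- S] %% 4 != 2)%N)
  (bitstrings 8).
suff: test segre_bits O345_bits by [].
by vm_compute.
Qed.

Lemma mem_antipodal_pairs s t :
  ((s, t) \in antipodal_pairs) = [&& s \in cells, t \in cells & antipodal s t].
Proof.
rewrite mem_filter andbC andbA; congr (_ && _).
by apply/allpairsP/andP=> [[[a b] [? ? [-> ->]]]|[? ?]]; last exists (s, t).
Qed.

Lemma ord_mem_cells (i j k : 'I_3) : (i : nat, j : nat, k : nat) \in cells.
Proof. by rewrite mem_cells !ltn_ord. Qed.

Lemma mem_antipodal_ord (i j k a b c : 'I_3) :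
  (((i : nat, j : nat, k : nat), (a : nat, b : nat, c : nat))
      \in antipodal_pairs) = [&& i != a, j != b & k != c].
Proof. by rewrite mem_antipodal_pairs !ord_mem_cells. Qed.

Lemma antipodal_pairsP p : p \in antipodal_pairs ->
  exists (i j k a b c : 'I_3),
    [/\ i != a, j != b, k != c
      & p = ((i : nat, j : nat, k : nat), (a : nat, b : nat, c : nat))].
Proof.
case: p => [[[i j] k] [[a b] c]]; rewrite mem_antipodal_pairs !mem_cells /=.
case/and3P=> /and3P[/= lti ltj ltk] /and3P[/= lta ltb ltc].
case/and3P=> /= ia jb kc.
by exists (Ordinal lti), (Ordinal ltj), (Ordinal ltk),
          (Ordinal lta), (Ordinal ltb), (Ordinal ltc).
Qed.

(** * Coordinates *)

Section Segre.

Variable u : 'I_3 -> 'rV['F_2]_2.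
Hypotheses (u_neq0 : forall i, u i != 0) (u_inj : injective u).

Definition dualE (i j k : 'I_3) : 'cV['F_2]_8 :=
  perp (u i) *t perp (u j) *t perp (u k).

Lemma mulE_dualE a b c i j k :
  (E u a b c *m dualE i j k) 0 0 = [&& a != i, b != j & c != k]%:R.
Proof.
(* The dimensions 4 and 8 have to be read as 2 * 2 and 4 * 2. *)
rewrite [LHS](@mul_tens_rv_cv 4 2 (u a *t u b) (u c)
                (perp (u i) *t perp (u j)) (perp (u k))).
rewrite [X in X * _](@mul_tens_rv_cv 2 2 (u a) (u b) (perp (u i)) (perp (u j))).
rewrite !mul_perp // !(inj_eq u_inj).
by rewrite -!natrM !mulnb andbA.
Qed.

Definition Ecell (t : cell) : 'rV['F_2]_8 :=
  E u (inord t.1.1) (inord t.1.2) (inord t.2).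

Definition dual_cell (t : cell) : 'cV['F_2]_8 :=
  dualE (inord t.1.1) (inord t.1.2) (inord t.2).

Lemma mulEcell_dual s t : s \in cells -> t \in cells ->
  (Ecell s *m dual_cell t) 0 0 = (antipodal s t)%:R.
Proof.
case: s t => [[a b] c] [[i j] k]; rewrite !mem_cells.
case/and3P=> /= lta ltb ltc /and3P[/= lti ltj ltk].
by rewrite mulE_dualE // /antipodal /= -!val_eqE /= !inordK.
Qed.

Lemma ebasisE : map Ecell basis_cells = ebasis u :> seq _.
Proof. by []. Qed.

Lemma dual_basis (k : 'I_8 -> 'F_2) (j : 'I_8) :
  ((\sum_i k i *: (ebasis u)`_i)
     *m dual_cell (nth (0, 0, 0)%N (rev basis_cells) j)) 0 0 = k j.
Proof.
rewrite mulmx_suml summxE (bigD1 j) //= big1 => [|i neq_ij].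
all: rewrite -scalemxAl mxE -ebasisE (nth_map (0, 0, 0)%N) //.
all: rewrite mulEcell_dual ?antipodal_basis;
  last by rewrite sub_basis_cells ?mem_nth.
all: try by rewrite sub_basis_cells -1?mem_rev ?revK ?mem_nth.
  by rewrite eqxx mulr1 addr0.
by rewrite (negbTE neq_ij) mulr0.
Qed.

Lemma ebasis_basis : basis_of fullv (ebasis u).
Proof.
rewrite basisEfree subvf dimvf size_tuple; apply/andP; split=> //.
by apply/freeP => k k0 j; rewrite -(dual_basis k) k0 mul0mx mxE.
Qed.

Definition coords (x : 'rV['F_2]_8) : bitseq :=
  [seq (x *m dual_cell t) 0 0 != 0 | t <- rev basis_cells].

Lemma coord_ebasis (j : 'I_8) x :
  coord (ebasis u) j x = (nth false (coords x) j)%:R.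
Proof.
rewrite (nth_map (0, 0, 0)%N) // [x in RHS](coord_basis ebasis_basis (memvf x)).
by rewrite (dual_basis (fun i => coord (ebasis u) i x)) -F2_natb.
Qed.

Lemma coords_inj : injective coords.
Proof.
move=> x y eq_xy; rewrite (coord_basis ebasis_basis (memvf x)).
rewrite [RHS](coord_basis ebasis_basis (memvf y)).
by apply: eq_bigr => i _; rewrite !coord_ebasis eq_xy.
Qed.

Lemma coords_onto s : size s = 8 -> exists x, coords x = s.
Proof.
move=> size_s; exists (\sum_(i < 8) (nth false s i)%:R *: (ebasis u)`_i).
apply: (@eq_from_nth _ false); rewrite ?size_s // => i lti.
rewrite (nth_map (0, 0, 0)%N) // (dual_basis _ (Ordinal lti)).
by rewrite F2_nat_eq0 oddb negbK.
Qed.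

Lemma coordsD x y : coords (x + y) = xorb (coords x) (coords y).
Proof.
rewrite /coords /xorb; elim: (rev basis_cells) => //= t ts ->.
by rewrite mulmxDl mxE addF2_neq0.
Qed.

Lemma coords0 : coords 0 = nseq 8 false.
Proof.
rewrite /coords (eq_map (_ : _ =1 xpred0)) => [//|t].
by rewrite mul0mx mxE eqxx.
Qed.

Lemma coords_Ecell t : t \in cells -> coords (Ecell t) = tensor_bits t.
Proof.
move=> t_in; apply/eq_in_map => s /sub_basis_cells s_in.
by rewrite mulEcell_dual // F2_nat_eq0 oddb negbK.
Qed.

Lemma coords_E (i j k : 'I_3) :
  coords (E u i j k) = tensor_bits (i : nat, j : nat, k : nat).
Proof. by rewrite -coords_Ecell ?ord_mem_cells // /Ecell !inord_val. Qed.

Lemma perm_coords (A : {set 'rV['F_2]_8}) (L : seq bitseq) :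
    (forall x, (x \in A) = (coords x \in L)) -> uniq L ->
    all (fun s => size s == 8) L ->
  perm_eq (map coords (enum A)) L.
Proof.
move=> memA uniqL /allP size8; apply: uniq_perm => // [|s].
  by rewrite map_inj_uniq ?enum_uniq //; apply: coords_inj.
apply/mapP/idP=> [[x]|s_in]; first by rewrite mem_enum memA => ? ->.
have [x def_s] := coords_onto (eqP (size8 s s_in)).
by exists x; rewrite // mem_enum memA def_s.
Qed.

(** * The orbits in coordinates *)

Lemma E_inj a b c i j k : E u a b c = E u i j k -> [/\ a = i, b = j & c = k].
Proof.
move/(congr1 coords); rewrite !coords_E.
move/(tensor_bits_inj (ord_mem_cells _ _ _) (ord_mem_cells _ _ _)).
by case=> /ord_inj-> /ord_inj-> /ord_inj->.
Qed.

(** The functionals [perp (u l)] separate vectors, because a nonzero vector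
    killed by all three would be equal to [u 0], [u 1] and [u 2]. *)
Lemma addu i a : i != a -> u i + u a = u (- (i + a)).
Proof.
move=> ia; apply/eqP; rewrite -subr_eq0 oppv_F2; set x := _ + _.
have perp0 l : (x *m perp (u l)) 0 0 = 0.
  rewrite !mulmxDl [LHS]mxE [X in X + _]mxE !mul_perp // !(inj_eq u_inj) -!natrD.
  apply/eqP; rewrite F2_nat_eq0.
  by case: i a l ia {x} => [[|[|[|//]]] ?] [[|[|[|//]]] ?] [[|[|[|//]]] ?].
apply/idPn=> x_neq0; have eq_ux l : u l = x.
  apply/eqP; rewrite eq_sym; have /eqP := perp0 l.
  by rewrite mul_perp // F2_nat_eq0 oddb negbK.
by have /u_inj/eqP := etrans (eq_ux i) (esym (eq_ux a)); rewrite (negPf ia).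
Qed.

Lemma E_addl i a j k : i != a -> E u i j k + E u a j k = E u (- (i + a)) j k.
Proof. by move=> ia; rewrite /E -addu // tensmxDl tensmxDl. Qed.

Lemma E_addm i j b k : j != b -> E u i j k + E u i b k = E u i (- (j + b)) k.
Proof. by move=> jb; rewrite /E -addu // tensmxDr tensmxDl. Qed.

Lemma E_addr i j k c : k != c -> E u i j k + E u i j c = E u i j (- (k + c)).
Proof. by move=> kc; rewrite /E -addu // tensmxDr. Qed.

Lemma tangentP i j k x :
  reflect (exists a b c, [/\ i != a, j != b, k != c
             & x = E u a j k + E u i b k + E u i j c])
          ((x \in tangent u (E u i j k)) && (x != E u i j k)).
Proof. exact: (tangent_pointP mulE_dualE E_addl E_addm E_addr E_inj). Qed.

Lemma O4P x : reflect
  (exists i j k a b c,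
     [/\ i != a, j != b, k != c & x = E u a j k + E u i b k + E u i j c])
  (x \in O4 u).
Proof.
rewrite in_setD; apply: (iffP andP) => [[xS /bigcupP[_ /imsetP[t _ ->]]]|].
  case: t => -[i j] k x_tan.
  have x_neq : x != E u i j k.
    by apply: contraNneq xS => ->; apply: (imset_f _ (x := (i, j, k))).
  have /tangentP[a [b [c ?]]] := introT andP (conj x_tan x_neq).
  by exists i, j, k, a, b, c.
case=> i [j [k [a [b [c [ia jb kc def_x]]]]]].
have /andP[x_tan _] : (x \in tangent u (E u i j k)) && (x != E u i j k).
  by apply/tangentP; exists a, b, c.
split; last first.
  by apply/bigcupP; exists (E u i j k) => //; apply: (imset_f _ (x := (i, j, k))).
apply/imsetP=> -[[[l m] n] _ /= def_E].
exact: (tangent_point_neq mulE_dualE ia jb kc (etrans (esym def_x) def_E)).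
Qed.

Lemma mem_segre x : (x \in segre u) = (coords x \in segre_bits).
Proof.
apply/imsetP/mapP=> [[[[i j] k] _ ->]|[t t_in eq_xt]].
  exists (i : nat, j : nat, k : nat); first exact: ord_mem_cells.
  by rewrite coords_E.
exists (inord t.1.1, inord t.1.2, inord t.2) => //.
by apply: coords_inj; rewrite eq_xt -coords_Ecell.
Qed.

Lemma mem_O3 x : (x \in O3 u) = (coords x \in O3_bits).
Proof.
rewrite inE; apply/idP/mapP => [|[p /antipodal_pairsP]].
  case/existsP=> i /existsP[j /existsP[k /existsP[a /existsP[b /existsP[c]]]]].
  case/and4P=> ia jb kc /eqP->.
  exists ((i : nat, j : nat, k : nat), (a : nat, b : nat, c : nat)).
    by rewrite mem_antipodal_ord; apply/and3P.
  by rewrite coordsD !coords_E.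
case=> i [j [k [a [b [c [ia jb kc ->]]]]]] /= eq_x.
apply/existsP; exists i; apply/existsP; exists j; apply/existsP; exists k.
apply/existsP; exists a; apply/existsP; exists b; apply/existsP; exists c.
rewrite ia jb kc; apply/eqP/coords_inj.
by rewrite eq_x coordsD !coords_E.
Qed.

Lemma mem_O4 x : (x \in O4 u) = (coords x \in O4_bits).
Proof.
rewrite /O4_bits -map_comp; apply/O4P/mapP => [|[p /antipodal_pairsP]].
  case=> i [j [k [a [b [c [ia jb kc ->]]]]]].
  exists ((i : nat, j : nat, k : nat), (a : nat, b : nat, c : nat)).
    by rewrite mem_antipodal_ord; apply/and3P.
  by rewrite !coordsD !coords_E.
case=> i [j [k [a [b [c [ia jb kc ->]]]]]] /= eq_x.
exists i, j, k, a, b, c; split=> //; apply: coords_inj.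
by rewrite eq_x !coordsD !coords_E.
Qed.

Definition O345 : {set 'rV['F_2]_8} := O3 u :|: O4 u :|: O5 u.

Lemma mem_O345 x : (x \in O345) = (coords x \in O345_bits).
Proof.
by rewrite !in_setU mem_undup !mem_cat mem_O3 mem_O4 mem_segre orbA.
Qed.

Lemma card_O345 : #|O345| = 189%N.
Proof.
rewrite cardE -(size_map coords) (perm_size (perm_coords mem_O345 _ _)).
- by vm_compute.
- exact: undup_uniq.
- by vm_compute.
Qed.

(** * Invariance *)

(** Since [x + p + q = r] means [x = p + q + r], this is the number of ordered
    triples of points with sum [x], repetitions allowed. *)
Definition segre_triples (x : 'rV['F_2]_8) : nat :=
  (\sum_(p in segre u) \sum_(q in segre u) ((x + p + q)%R \in segre u))%N.

Lemma big_segre (F : bitseq -> nat) :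
  (\sum_(x in segre u) F (coords x))%N = sumn (map F segre_bits).
Proof.
rewrite -big_enum sumnE big_map -(big_map coords xpredT F).
by rewrite (perm_big _ (perm_coords mem_segre _ _)) //; vm_compute.
Qed.

Lemma segre_triplesE x : segre_triples x = segre_triples_bits (coords x).
Proof.
rewrite /segre_triples_bits -big_segre; apply: eq_bigr => p _.
pose F s : nat := xorb (xorb (coords x) (coords p)) s \in segre_bits.
rewrite -[RHS]sumn_count -(big_segre F).
by apply: eq_bigr => q _; rewrite /F -!coordsD mem_segre.
Qed.

(** Let [t] be the number of 3-subsets of the Segre variety with sum [x].  If
    [x] is outside the variety, the triples counted are the orderings of these
    subsets, and there are [6 * t] of them.  If [x] belongs to the variety,
    then [x] with a repeated point gives [3 * 27 - 2 = 79] further triples;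
    in this case [t = 12].  The residue 2 modulo 4 thus means that [t] is odd.
    The values of [t] are 12, 10 and 12 on [O3], [O4] and [O5], 3 and 13 at the
    other points, and 27 at the zero vector. *)
Lemma mem_O345_triples x : (x \in O345) = (segre_triples x %% 4 != 2)%N.
Proof.
rewrite mem_O345 segre_triplesE; apply/eqP.
exact: (allP O345_bits_triples (coords x) (mem_bitstrings _)).
Qed.

Lemma acts_O345 : [acts segre_stab u, on O345 | GL8_action].
Proof.
apply/subsetP=> g stab_g; rewrite inE in_setT inE.
apply/subsetP=> x; rewrite [in X in _ -> X]inE !mem_O345_triples.
suff -> : segre_triples (GL8_action x g) = segre_triples x by [].
have segre_g y : (GL8_action y g \in segre u) = (y \in segre u).
  exact: (astabs_act y stab_g).
have actD y z : GL8_action (y + z) g = GL8_action y g + GL8_action z g.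
  exact: mulmxDl.
rewrite /segre_triples (reindex_astabs _ _ stab_g).
apply: eq_bigr => p _; rewrite (reindex_astabs _ _ stab_g).
by apply: eq_bigr => q _; rewrite -!actD segre_g.
Qed.

(** * The equation *)

Lemma Q4'_eval x :
  (Q4'.@[fun i => coord (ebasis u) i x] == 0) = ~~ quartic_bits (coords x).
Proof.
rewrite Q4'E eval_sum_monomials F2_nat_eq0; congr (~~ odd _).
apply: eq_in_count => s /Q4'_square_free/andP[_ /allP s_range].
apply: eq_in_all => i /s_range /andP[i_gt0 i_lt9].
by rewrite coord_ebasis // F2_nat_eq0 oddb negbK inordK // prednK.
Qed.

Lemma O345_equation : reduced_equation u O345 Q4'.
Proof.
split; [by move=> m m_in i; apply: Q4'_reduced | exact: Q4'_constant_coef |].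
apply/setP=> x; rewrite mem_O345 [RHS]inE Q4'_eval.
rewrite -(inj_eq coords_inj) coords0.
exact/eqP/(allP O345_bits_quartic (coords x) (mem_bitstrings _)).
Qed.

End Segre.

Theorem theorem16 (u : 'I_3 -> 'rV['F_2]_2)
    (u_neq0 : forall i, u i != 0) (u_inj : injective u) :
  let psi := O3 u :|: O4 u :|: O5 u in
  [/\ #|psi| = 189%N,
      [acts segre_stab u, on psi | GL8_action],
      quartic_hypersurface u psi &
      reduced_equation u psi Q4'].
Proof.
have eqQ := O345_equation u_neq0 u_inj.
split; [exact: card_O345 | exact: acts_O345 | | exact: eqQ].
by exists Q4'; [exact: eqQ | exact: msize_Q4'].
Qed.
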